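(* Let $I$ be a nonempty finite set. For each $i\in I$ the element $\mathtt{D}_i$ is a primitive element of $\mathbf{\Sigma}[I]$; hence so is $\mathtt{D}_I$.
   Context: Let $\Bbbk$ be the base field. A composition $F=(I_1,\dots,I_k)\vDash I$ of a finite set $I$ is a sequence of pairwise disjoint nonempty subsets with union $I$; $\ell(F)=k$, and $\omega(F)=I_k$ is the last block. $\mathbf{\Sigma}[I]$ is the $\Bbbk$-vector space with basis $\mathtt{H}_F$, $F\vDash I$. For $I=S\sqcup T$ (disjoint subsets with union $I$), the coproduct $\Delta_{S,T}:\mathbf{\Sigma}[I]\to\mathbf{\Sigma}[S]\otimes\mathbf{\Sigma}[T]$ is $\Delta_{S,T}(\mathtt{H}_F)=\mathtt{H}_{F|_S}\otimes\mathtt{H}_{F|_T}$, where $F|_S$ is the list of the nonempty sets among $I_1\cap S,\dots,I_k\cap S$, in order. An element $z\in\mathbf{\Sigma}[I]$ is primitive if $\Delta_{S,T}(z)=0$ for all $I=S\sqcup T$ with $S,T\ne\emptyset$. For $i\in I$, $\mathtt{D}_i=\sum_{F\vDash I:\ i\in\omega(F)}(-1)^{\ell(F)-1}\mathtt{H}_F$, the sum over compositions of $I$ whose last block contains $i$; and $\mathtt{D}_I=\sum_{i\in I}\mathtt{D}_i$ (the Dynkin quasi-idempotent). *)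

(* Defs.v *)
From HB Require Import structures.
From mathcomp Require Import all_boot all_order all_algebra.

Set Implicit Arguments.
Unset Strict Implicit.
Unset Printing Implicit Defensive.

Import GRing.Theory.

Section Compositions.
Variable U : finType.
Implicit Types (A S : {set U}) (s : seq {set U}).

Definition is_composition A s : bool :=
  [&& set0 \notin s,
      pairwise (fun B C : {set U} => [disjoint B & C]) s
    & \bigcup_(B <- s) B == A].

Record composition A := Composition {
  blocks :> seq {set U};
  blocksP : is_composition A blocks
}.

HB.instance Definition _ A := [isSub for @blocks A].
HB.instance Definition _ A := [Choice of composition A by <:].

Lemma composition_uniq A s : is_composition A s -> uniq s.
Proof.
case/and3P=> + + _; elim: s => //= B s IHs.
rewrite inE negb_or => /andP[nB n0] /andP[/allP dB ds].
rewrite IHs // andbT; apply: contra nB => /dB.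
by rewrite -setI_eq0 setIid eq_sym.
Qed.

Lemma size_composition A (F : composition A) : size F <= #|{set U}|.
Proof.
by rewrite -(card_uniqP (composition_uniq (blocksP F))) max_card.
Qed.

Definition bseq_of_composition A (F : composition A) :
  {bseq #|{set U}| of {set U}} := Bseq (size_composition F).

Lemma bseq_of_compositionK A :
  pcancel (@bseq_of_composition A)
          (fun b => insub (b : seq {set U}) : option (composition A)).
Proof. by move=> F; rewrite /= valK. Qed.

HB.instance Definition _ A := Countable.copy (composition A)
  (pcan_type (@bseq_of_compositionK A)).
HB.instance Definition _ A := isFinite.Build (composition A)
  (pcan_enumP (@bseq_of_compositionK A)).

Definition last_block A (F : composition A) : {set U} := last set0 F.

Definition restr_blocks S s : seq {set U} :=
  [seq B <- [seq C :&: S | C <- s] | B != set0].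

Lemma restr_composition A S s :
  S \subset A -> is_composition A s -> is_composition S (restr_blocks S s).
Proof.
move=> sSA /and3P[_ ds /eqP defA]; apply/and3P; split.
- by rewrite mem_filter eqxx.
- apply: pairwise_filter; rewrite pairwise_map.
  apply: sub_pairwise ds => B C /=; rewrite -!setI_eq0 => /eqP dBC.
  by rewrite setIACA dBC set0I.
- rewrite big_filter big_map big_mkcond /=.
  rewrite (eq_bigr (fun B => B :&: S)); last by move=> B _; case: eqP.
  by rewrite -big_distrl /= defA; apply/eqP/setIidPr.
Qed.

Definition restr A S (sSA : S \subset A) (F : composition A) : composition S :=
  Composition (restr_composition sSA (blocksP F)).

Definition decomposes A S T : bool := (S :|: T == A) && [disjoint S & T].

Lemma decomposesl A S T : decomposes A S T -> S \subset A.
Proof. by case/andP=> /eqP <- _; apply: subsetUl. Qed.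

Lemma decomposesr A S T : decomposes A S T -> T \subset A.
Proof. by case/andP=> /eqP <- _; apply: subsetUr. Qed.

End Compositions.

Local Open Scope ring_scope.

Section Sigma.
Variables (k : fieldType) (U : finType).
Implicit Types A S T : {set U}.

Definition Sigma A := {ffun composition A -> k^o}.
HB.instance Definition _ A := Vector.on (Sigma A).

Definition basisH A (F : composition A) : Sigma A := [ffun G => (G == F)%:R].

Lemma H_expand A (z : Sigma A) : z = \sum_F z F *: basisH F.
Proof.
apply/ffunP=> G; rewrite sum_ffunE (bigD1 G) //= !ffunE eqxx.
rewrite [X in X + _]mulr1 big1 ?addr0 // => F nF.
by rewrite !ffunE eq_sym (negPf nF) [LHS]mulr0.
Qed.

(* Σ[S] ⊗ Σ[T], realized as the vector space on the product of the two bases;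
   tensor_universal below is its universal property. *)
Definition SigmaTensor S T := {ffun composition S * composition T -> k^o}.
HB.instance Definition _ S T := Vector.on (SigmaTensor S T).

Definition tensor S T (x : Sigma S) (y : Sigma T) : SigmaTensor S T :=
  [ffun p => x p.1 * y p.2].

Definition coproduct A S T (dec : decomposes A S T) (z : Sigma A) :
    SigmaTensor S T :=
  \sum_F z F *: tensor (basisH (restr (decomposesl dec) F))
                       (basisH (restr (decomposesr dec) F)).

Lemma coproduct_is_linear A S T (dec : decomposes A S T) :
  linear (coproduct dec).
Proof.
move=> a x y; rewrite /coproduct scaler_sumr -big_split /=.
by apply: eq_bigr => F _; rewrite !ffunE scalerDl scalerA.
Qed.

HB.instance Definition _ A S T (dec : decomposes A S T) :=
  GRing.isLinear.Build k (Sigma A) (SigmaTensor S T) *:%R (coproduct dec)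
    (coproduct_is_linear dec).

Lemma coproductH A S T (dec : decomposes A S T) (F : composition A) :
  coproduct dec (basisH F) =
    tensor (basisH (restr (decomposesl dec) F)) (basisH (restr (decomposesr dec) F)).
Proof.
rewrite /coproduct (bigD1 F) //= ffunE eqxx scale1r big1 ?addr0 // => G nG.
by rewrite ffunE (negPf nG) scale0r.
Qed.

Lemma tensor_universal S T (V : lmodType k) (f : Sigma S -> Sigma T -> V) :
    (forall x, linear (f x)) -> (forall y, linear (f^~ y)) ->
  exists g : {linear SigmaTensor S T -> V},
    (forall x y, g (tensor x y) = f x y) /\
    (forall h : {linear SigmaTensor S T -> V},
       (forall x y, h (tensor x y) = f x y) -> h =1 g).
Proof.
move=> fr fl.
pose g0 (w : SigmaTensor S T) := \sum_p w p *: f (basisH p.1) (basisH p.2).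
have g0l : linear g0.
  move=> a x y; rewrite /g0 scaler_sumr -big_split /=.
  by apply: eq_bigr => p _; rewrite !ffunE scalerDl scalerA.
pose gM := GRing.isLinear.Build k (SigmaTensor S T) V *:%R g0 g0l.
pose g : {linear SigmaTensor S T -> V} := HB.pack g0 gM.
have expand (w : SigmaTensor S T) : w = \sum_p w p *: tensor (basisH p.1) (basisH p.2).
  apply/ffunP=> q; rewrite sum_ffunE (bigD1 q) //= !ffunE !eqxx mulr1.
  rewrite [X in X + _]mulr1 big1 ?addr0 // => p nq.
  rewrite !ffunE -natrM mulnb -[_ && _]/(q == p) eq_sym (negPf nq).
  exact: mulr0.
exists g; split=> [x y | h hf w]; last first.
  rewrite {1}(expand w) linear_sum; apply: eq_bigr => p _.
  by rewrite linearZ hf.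
pose frM x := GRing.isLinear.Build k (Sigma T) V *:%R (f x) (fr x).
pose frL x : {linear Sigma T -> V} := HB.pack (f x) (frM x).
pose flM y := GRing.isLinear.Build k (Sigma S) V *:%R (f^~ y) (fl y).
pose flL y : {linear Sigma S -> V} := HB.pack (f^~ y) (flM y).
rewrite -[RHS]/(flL y x) [in RHS](H_expand x) linear_sum /=.
rewrite /g0 (eq_bigr (fun p =>
  x p.1 *: (y p.2 *: f (basisH p.1) (basisH p.2)))); last first.
  by move=> p _; rewrite ffunE scalerA.
rewrite -(pair_big xpredT xpredT
  (fun F G => x F *: (y G *: f (basisH F) (basisH G)))) /=.
apply: eq_bigr => F _; rewrite -scaler_sumr.
rewrite -[RHS]/(flL y (x F *: basisH F)) linearZ /=; congr (_ *: _).
rewrite -[RHS]/(frL (basisH F) y) [in RHS](H_expand y) linear_sum.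
by apply: eq_bigr => G _; rewrite linearZ.
Qed.

Definition primitive A (z : Sigma A) : Prop :=
  forall S T (dec : decomposes A S T),
    S != set0 -> T != set0 -> coproduct dec z = 0.

Definition dynkin_at A (i : U) : Sigma A :=
  \sum_(F : composition A | i \in last_block F) (-1) ^+ (size F).-1 *: basisH F.

Definition dynkin A : Sigma A := \sum_(i in A) dynkin_at A i.

End Sigma.

(* Main.v *)
Require Import Defs.
From mathcomp Require Import all_boot all_order all_algebra.

(** Expanding [dynkin_at k I i] in the tensor basis, each coefficient of its
    coproduct is a signed count of the compositions [F] with [i] in the last
    block and prescribed restrictions to [S] and [T].  Let [X] be the one of
    [S], [T] not containing [i], and look at the last block of [F] meeting [X].
    If it is contained in [X], it is not the last block of [F], and it can be
    merged with its successor, which is disjoint from [X]; otherwise it can be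
    split into its part in [X] followed by its part outside [X].  These moves
    are mutually inverse, keep both restrictions and keep [i] in the last block,
    but change the length by one, so the signed count vanishes. *)

Set Implicit Arguments.
Unset Strict Implicit.
Unset Printing Implicit Defensive.

Import GRing.Theory.
Local Open Scope ring_scope.

(* The parity [e] is there because [a (f x) = - a x] alone would only give
   twice the sum equal to zero, which is not enough in characteristic 2. *)
Lemma sum_sign_reversing (V : zmodType) (X : finType) (P e : pred X)
    (f : X -> X) (a : X -> V) :
  (forall x, P x ->
     [/\ P (f x), f (f x) = x, e (f x) = ~~ e x & a (f x) = - a x]) ->
  \sum_(x | P x) a x = 0.
Proof.
move=> fP; rewrite (bigID e) /=.
rewrite [X in _ + X](reindex_onto f f) /=; last first.
  by move=> x /andP[/fP[]].
rewrite [X in _ + X](eq_bigl (fun x => P x && e x)); last first.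
  move=> x; apply/idP/idP.
    case/andP=> /andP[Pfx efx] /eqP ffx.
    have [+ _ + _] := fP _ Pfx; rewrite ffx => -> ->; exact: efx.
  by case/andP=> /fP[-> -> -> _] ->; rewrite eqxx.
rewrite -big_split big1 //= => x /andP[/fP[_ _ _ ->] _].
exact: subrr.
Qed.

Lemma has_split_last (T : Type) (p : pred T) (s : seq T) :
  has p s -> exists s1 x s2, [/\ s = s1 ++ x :: s2, p x & ~~ has p s2].
Proof.
elim: s => //= y s IHs; have [/IHs[s1 [x [s2 [-> px ps2]]]] _ | ps] := boolP (has p s).
  by exists (y :: s1), x, s2.
by rewrite orbF => py; exists [::], y, s.
Qed.

Section Toggle.
Variable U : finType.
Implicit Types (A B C X Y : {set U}) (s : seq {set U}).

Definition meets X B := B :&: X != set0.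

(** Being a relation, the merging move can be read in both directions, so an invariant proved for it
    also covers splitting. *)
Variant merges X : seq {set U} -> seq {set U} -> Prop :=
  Merges s1 B C s2 of B != set0 & B \subset X & C != set0
      & C :&: X = set0 & ~~ has (meets X) s2 :
    merges X (s1 ++ B :: C :: s2) (s1 ++ B :|: C :: s2).

(** The recursion stops at the last block meeting [X]. Two cases give meaningless values and are
    excluded in [merges_toggle]: no block meets [X], or that last one lies in [X] and has no
    successor. *)
Fixpoint toggle X s :=
  if s is B :: s' then
    if has (meets X) s' then B :: toggle X s'
    else if B \subset X then
      if s' is C :: s'' then B :|: C :: s'' else s
    else B :&: X :: B :\: X :: s'
  else s.

Lemma toggle_cat X s1 B s2 : meets X B ->
  toggle X (s1 ++ B :: s2) = s1 ++ toggle X (B :: s2).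
Proof.
by move=> mB; elim: s1 => //= D s1 <-; rewrite has_cat /= mB orbT.
Qed.

(** The last blocks meeting [X] are [B] in [s] and [B :|: C] in [s']. The latter is not contained in
    [X], and [X] cuts it back into [B] and [C]. *)
Lemma toggle_merges X s s' :
  merges X s s' -> toggle X s = s' /\ toggle X s' = s.
Proof.
case=> s1 B C s2 nB sBX nC CX ms2.
have BX : B :&: X = B by apply/setIidPl.
have mBC : meets X (B :|: C) by rewrite /meets setIUl BX CX setU0.
rewrite !toggle_cat //; last by rewrite /meets BX.
have nsCX : ~~ (C \subset X).
  by apply: contra nC => /setIidPl <-; rewrite CX.
have BDX : B :\: X = set0 by apply/eqP; rewrite setD_eq0.
have CDX : C :\: X = C by apply/setDidPl; rewrite -setI_eq0 CX.
rewrite /= /meets CX eqxx (negPf ms2) sBX subUset sBX (negPf nsCX) /=.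
by rewrite setIUl BX CX setU0 setDUl BDX CDX set0U.
Qed.

Lemma merges_toggle X A s (i : U) : is_composition A s ->
    X \subset A -> X != set0 -> i \notin X -> i \in last set0 s ->
  merges X s (toggle X s) \/ merges X (toggle X s) s.
Proof.
move=> /and3P[n0 _ /eqP defA] sXA /set0Pn[x xX] niX ilast.
have /has_split_last[s1 [B [s2 [defs mB ms2]]]] : has (meets X) s.
  have := subsetP sXA x xX; rewrite -defA big_tnth => /bigcupP[j _ xB].
  by apply/hasP; exists (tnth (in_tuple s) j); rewrite ?mem_tnth //;
     apply/set0Pn; exists x; rewrite inE xB.
move: n0 ilast; rewrite defs {s defs defA} mem_cat !inE last_cat /= toggle_cat //=.
rewrite (negPf ms2) !negb_or => /and3P[_ nB ns2] il.
have [sBX | nsBX] := boolP (B \subset X).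
  (* Without a successor, [B] would be the last block, forcing [i] into [X]. *)
  case: s2 ms2 ns2 il => [_ _ /(subsetP sBX) iX | C s2]; first by rewrite iX in niX.
  rewrite /= negb_or negbK inE negb_or => /andP[/eqP CX ms2] /andP[nC _] _.
  by left; split; rewrite // eq_sym.
(* Written as the union of its parts inside and outside [X], [B] is visibly the outcome of a
   merge. *)
right; rewrite -[in X in merges _ _ X](setID B X); split=> //.
- exact: subsetIr.
- by rewrite setD_eq0.
- by rewrite setIDAC setDIl setDv setI0.
Qed.

Section Merges.
Variables (X : {set U}) (s s' : seq {set U}).
Hypothesis ss' : merges X s s'.

Lemma merges_composition A : is_composition A s' = is_composition A s.
Proof.
case: ss' => s1 B C s2 nB sBX nC CX _; rewrite /is_composition.
have dBC : [disjoint B & C].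
  by rewrite -setI_eq0 -(setIidPl sBX) -setIA [X :&: C]setIC CX setI0.
congr [&& _, _ & _].
- rewrite !mem_cat !inE ![set0 == _]eq_sym setU_eq0.
  by rewrite (negPf nB) (negPf nC).
- have dU (D : {set U}) : [disjoint D & B :|: C] = [disjoint D & B] && [disjoint D & C].
    by rewrite -!setI_eq0 setIUr setU_eq0.
  have dUl (D : {set U}) : [disjoint B :|: C & D] = [disjoint B & D] && [disjoint C & D].
    by rewrite -!setI_eq0 setIUl setU_eq0.
  rewrite !pairwise_cat /= dBC /= !allrel_consr.
  rewrite (eq_all dU) (eq_all dUl) !all_predI -!andbA.
  by do !bool_congr.
- by rewrite !big_cat !big_cons /= -setUA.
Qed.

(** [C] leaves no trace on [X], and [B] none on a set disjoint from [X]; the trace of [B :|: C] is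
    then that of the other block. *)
Lemma merges_restr_blocks Y : Y = X \/ Y :&: X = set0 ->
  restr_blocks Y s' = restr_blocks Y s.
Proof.
move=> YX; case: ss' => s1 B C s2 nB sBX nC CX _.
rewrite /restr_blocks !map_cat !filter_cat /= setIUl; congr (_ ++ _).
case: YX => [-> | YX]; first by rewrite CX setU0 eqxx.
have -> : B :&: Y = set0.
  by rewrite -(setIidPl sBX) -setIA [X :&: Y]setIC YX setI0.
by rewrite set0U eqxx.
Qed.

Lemma merges_last i : i \notin X -> (i \in last set0 s') = (i \in last set0 s).
Proof.
case: ss' => s1 B C s2 _ sBX _ _ _ niX; rewrite !last_cat /=.
case: s2 => //=; rewrite inE; case: (boolP (i \in B)) => // iB.
by rewrite (subsetP sBX) in niX.
Qed.

(** Positivity makes the truncated predecessor, which is the exponent of the sign, change parity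
    too. *)
Lemma merges_size : size s = (size s').+1 /\ (0 < size s')%N.
Proof. by case: ss' => s1 B C s2 _ _ _ _ _; rewrite !size_cat /= !addnS. Qed.

End Merges.

Variables (A X : {set U}) (i : U).
Hypotheses (sXA : X \subset A) (nX : X != set0) (niX : i \notin X).

(** The fallback of [insubd] only makes the map total: if [i] is in the last block of [F], then
    [toggle X F] is a composition. *)
Definition toggle_composition (F : composition A) : composition A :=
  insubd F (toggle X F).

Lemma toggle_compositionP (F : composition A) (G := toggle_composition F) :
    i \in last_block F ->
  [/\ toggle_composition G = F, merges X F G \/ merges X G F
    & i \in last_block G].
Proof.
move=> iF; have mFt := merges_toggle (blocksP F) sXA nX niX iF.
have valG : G = toggle X F :> seq _.
  rewrite val_insubd; case: ifP => // /negP[].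
  by case: mFt => /merges_composition => [-> | <-]; apply: blocksP.
have mFG : merges X F G \/ merges X G F by rewrite valG.
split=> //.
  apply: val_inj; rewrite val_insubd.
  have -> : toggle X G = F by case: mFG => /toggle_merges[].
  by rewrite (blocksP F).
by rewrite /last_block; case: mFG => /merges_last /(_ _ niX) => [-> | <-].
Qed.

Lemma toggle_restr (S : {set U}) (sSA : S \subset A) (F : composition A) :
    i \in last_block F -> S = X \/ S :&: X = set0 ->
  restr sSA (toggle_composition F) = restr sSA F.
Proof.
move=> /toggle_compositionP[_ mFG _] SX; apply: val_inj => /=.
by case: mFG => /merges_restr_blocks /(_ _ SX).
Qed.

(** The first parity serves as [e] in [sum_sign_reversing]; the second one flips the sign of the
    term. *)
Lemma toggle_odd_size (F : composition A) (G := toggle_composition F) :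
    i \in last_block F ->
  odd (size G) = ~~ odd (size F) /\ odd (size G).-1 = ~~ odd (size F).-1.
Proof.
case/toggle_compositionP=> _ mFG _.
case: mFG => /merges_size[]; rewrite -/G => -> /=.
  by rewrite negbK; case: (size G) => //= n; rewrite negbK.
by case: (size F) => //= n; rewrite negbK.
Qed.

End Toggle.

Lemma dynkin_at_primitive (k : fieldType) (U : finType) (I : {set U}) (i : U) :
  i \in I -> primitive (dynkin_at k I i).
Proof.
move=> iI S T dec nS nT; have /andP[/eqP defI dST] := dec.
have ST : S :&: T = set0 by apply/eqP; rewrite setI_eq0.
have [X [sXI nX niX SX TX]] : exists X : {set U},
    [/\ X \subset I, X != set0, i \notin X,
        S = X \/ S :&: X = set0 & T = X \/ T :&: X = set0].
  have [iS | niS] := boolP (i \in S).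
    exists T; split; [exact: decomposesr dec | by [] | | by right | by left].
    by rewrite (disjointFr dST iS).
  exists S; split; [exact: decomposesl dec | by [] | by [] | by left |].
  by right; rewrite setIC.
rewrite /dynkin_at linear_sum /=.
apply: (@sum_sign_reversing (SigmaTensor k S T) (composition I)
  (fun F => i \in last_block F) (fun F => odd (size F)) (@toggle_composition U I X)
  (fun F => coproduct dec ((-1) ^+ (size F).-1 *: basisH k F))) => F iF.
have [tK _ iG] := toggle_compositionP sXI nX niX iF.
have [oG oG'] := toggle_odd_size sXI nX niX iF.
split=> //; rewrite !linearZ /= !coproductH !(toggle_restr sXI nX niX) //.
by rewrite -signr_odd oG' signrN signr_odd scaleNr scalerN.
Qed.

Theorem proposition107 (k : fieldType) (U : finType) (I : {set U})
    (I_neq0 : I != set0) :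
  (forall i : U, i \in I -> primitive (dynkin_at k I i)) /\
  primitive (dynkin k I).
Proof.
split=> [i iI | S T dec nS nT]; first exact: dynkin_at_primitive.
rewrite linear_sum big1 // => i iI; exact: dynkin_at_primitive.
Qed.
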